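(* Let $n\ge 1$ be an integer and let $k=2n+1$ (so $k>1$ is odd). Put $N=k^2+\frac{3}{2}k+\frac{1}{2}$ (equivalently $N=4n^2+7n+3$), $a=n+1$ and $b=3n+2$. Then the three-quarters digraph $TQ(N,a,b)$ has diameter $k$. In particular, for every odd $k>1$ there exists a three-quarters digraph with diameter $k$ and $k^2+\frac{3}{2}k+\frac{1}{2}$ vertices.
   Context: For integers $N\ge 2$ and $1\le a,b\le N-1$ with $\gcd(N,a,b)=1$, the three-quarters digraph $TQ(N,a,b)$ has vertex set $\mathbb{Z}_N$ (integers modulo $N$), and each vertex $i$ is joined by arcs to $i+a$ and $i+b$ (mod $N$); it is the circulant digraph with steps $a,b$, equipped with the following distance-like function. For $x,y\in\mathbb{Z}_N$, $d(x,y)$ is the minimum integer $\ell\ge 0$ such that there exist integers $m,n'\ge 0$ with $m+n'=\ell$ and $$y-x\equiv ma+n'b,\quad\text{or}\quad y-x\equiv -ma+n'b,\quad\text{or}\quad y-x\equiv ma-n'b \pmod N.$$ (The combination $-ma-n'b$ with both $m,n'>0$ is not allowed.) The function $d$ is translation invariant, $d(x,y)=d(0,y-x)$, but need not be symmetric. The diameter of $TQ(N,a,b)$ is $\max_{x,y\in\mathbb{Z}_N} d(x,y)=\max_{z\in\mathbb{Z}_N} d(0,z)$. *)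

(* Defs.v *)
From mathcomp Require Import all_boot all_order all_algebra.

Set Implicit Arguments.
Unset Strict Implicit.
Unset Printing Implicit Defensive.

Import GRing.Theory.
Local Open Scope ring_scope.

Definition tq_valid (N a b : nat) : bool :=
  [&& (2 <= N)%N, (1 <= a <= N.-1)%N, (1 <= b <= N.-1)%N
    & gcdn (gcdn N a) b == 1%N].

Record tq_digraph : Type := TQ {
  tq_order : nat;
  tq_a : nat;
  tq_b : nat;
  tq_validP : tq_valid tq_order tq_a tq_b
}.

(* Since 2 <= tq_order G, 'Z_(tq_order G) really is Z modulo tq_order G. *)
Definition tq_vertex (G : tq_digraph) : finComNzRingType := 'Z_(tq_order G).

Definition tq_arc (G : tq_digraph) : rel (tq_vertex G) :=
  [rel i j | (j == i + (tq_a G)%:R) || (j == i + (tq_b G)%:R)].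

(* The distance is not the directed-path distance of tq_arc: steps may also be
   traversed backwards, but not both kinds of step backwards at once. The
   bounds m, m' <= l lose nothing, as m + m' = l. *)
Definition tq_reach (G : tq_digraph) (x y : tq_vertex G) (l : nat) : bool :=
  let a : tq_vertex G := (tq_a G)%:R in
  let b : tq_vertex G := (tq_b G)%:R in
  [exists m : 'I_l.+1, exists m' : 'I_l.+1,
    (m + m' == l)%N &&
    [|| y - x == a *+ m + b *+ m',
        y - x == - (a *+ m) + b *+ m'
      | y - x == a *+ m - b *+ m']].

Lemma tq_reach_ex (G : tq_digraph) (x y : tq_vertex G) :
  exists l : nat, tq_reach x y l.
Proof.
case: G x y => N a b /= vP; rewrite /tq_vertex /= => x y.
have /and4P [N2 /andP [a1 _] _ /eqP gcd1] := vP.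
have N0 : (N%:R : 'Z_N) = 0 by rewrite pchar_Zp.
have g0 : (0 < gcdn a b)%N by rewrite gcdn_gt0 a1.
have [u v uv _] := egcdnP N g0.
have [s t st _] := egcdnP b a1.
have g1 : gcdn (gcdn a b) N = 1%N by rewrite gcdnC gcdnA.
have E1 : (u%:R * (gcdn a b)%:R : 'Z_N) = 1.
  by rewrite -natrM uv g1 natrD natrM N0 mulr0 add0r.
have E2 : ((gcdn a b)%:R : 'Z_N) = s%:R * a%:R + (t * N.-1)%:R * b%:R.
  have NE : (N.-1%:R : 'Z_N) = - 1.
    by apply/eqP; rewrite -addr_eq0 natr1 prednK ?N0 // ltnW.
  rewrite -natrM st natrD natrM natrM NE mulrN1 mulNr.
  by rewrite addrAC subrr add0r.
pose z := nat_of_ord (y - x).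
have Ez : (z%:R : 'Z_N) = y - x by exact: natr_Zp.
set m := (z * u * s)%N; set m' := (z * u * (t * N.-1))%N.
exists (m + m')%N.
apply/existsP; exists (inord m); apply/existsP; exists (inord m') => /=.
rewrite !inordK ?ltnS ?leq_addl ?leq_addr // eqxx /=.
apply/orP; left; apply/eqP.
rewrite -[a%:R *+ m]mulr_natl -[b%:R *+ m']mulr_natl /m /m'.
rewrite (natrM _ (z * u)) [in X in _ = _ + X](natrM _ (z * u)) -!mulrA -mulrDr -E2.
by rewrite natrM -mulrA E1 mulr1 Ez.
Qed.

Definition tq_dist (G : tq_digraph) (x y : tq_vertex G) : nat :=
  ex_minn (tq_reach_ex x y).

Definition tq_diameter (G : tq_digraph) : nat :=
  \max_(x : tq_vertex G) \max_(y : tq_vertex G) tq_dist x y.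

(* Main.v *)
(* Since [N = (4n+3) a] and [b = 3a - 1], the pairs [(i, j)] of integers with
   [i a + j b = 0] modulo [N] form the lattice generated by [(4n+3, 0)] and
   [(n+1, n+1)]. For [0 <= j <= n] the row [j] of the admissible region of radius
   [2n+1] is [-(2n+1-j) <= i <= 2n+1-j], and the row [j - (n+1)], translated by
   [(n+1, n+1)], covers [n+1 <= i <= 2n+1+j]; together these contain [4n+3]
   consecutive values of [i], so every class is reached. The vertex [(2n+1) a]
   is not reached within distance [2n]: the second coordinate of any pair
   representing it is a multiple of [a = n+1], so it would be [0] or [a] or [-a],
   and each of these three rows requires a congruence modulo [4n+3] on the first
   coordinate that has no small enough solution. *)

Require Import Defs.
From mathcomp Require Import all_boot all_order all_algebra.
From mathcomp Require Import zify ring.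
Import GRing.Theory Num.Theory.
Local Open Scope ring_scope.

(** The bound on [N] matters because ['Z_0] and ['Z_1] are both the integers modulo 2. *)
Lemma intr_Zp_eq0 (N : nat) (c : int) : (1 < N)%N ->
  ((c%:~R : 'Z_N) == 0) = (N%:Z %| c)%Z.
Proof.
move=> N1; rewrite dvdzE /=.
have nat0 (m : nat) : ((m%:R : 'Z_N) == 0) = (N %| m)%N.
  by rewrite -val_eqE /= val_Zp_nat.
case: c => m; first by rewrite -pmulrn nat0.
by rewrite NegzE mulrNz oppr_eq0 -pmulrn nat0 abszN.
Qed.

(** Signed coordinates merge the three allowed sign patterns; the disjunction excludes exactly the
    open quadrant where both are negative. *)
Lemma tq_reachP (G : tq_digraph) (x y : tq_vertex G) (l : nat) :
  reflect (exists i j : int,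
             [/\ (`|i| + `|j|)%N = l, (0 <= i) || (0 <= j)
               & y - x = (i * (tq_a G)%:Z + j * (tq_b G)%:Z)%:~R])
          (tq_reach x y l).
Proof.
have pos (c m : nat) : ((m%:Z * c%:Z)%:~R : tq_vertex G) = c%:R *+ m.
  by rewrite -PoszM -pmulrn mulnC mulrnA.
have neg (c m : nat) : ((- m%:Z * c%:Z)%:~R : tq_vertex G) = - (c%:R *+ m).
  by rewrite mulNr mulrNz pos.
apply: (iffP existsP) => [[m /existsP [m' /andP [/eqP ml]]]|].
  case/or3P => /eqP ->.
  - by exists m%:Z, m'%:Z; rewrite intrD !pos; split.
  - by exists (- m%:Z), m'%:Z; rewrite intrD neg pos abszN orbT; split.
  - by exists m%:Z, (- m'%:Z); rewrite intrD neg pos abszN; split.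
move=> [i [j [ijl ij0 ->]]].
have il : (`|i| < l.+1)%N by rewrite -ijl ltnS leq_addr.
have jl : (`|j| < l.+1)%N by rewrite -ijl ltnS leq_addl.
exists (Ordinal il); apply/existsP; exists (Ordinal jl) => /=.
rewrite ijl eqxx /= intrD.
have [i0|i0] := boolP (0 <= i).
  have -> : i = `|i|%N by lia.
  have [j0|j0] := boolP (0 <= j).
    have -> : j = `|j|%N by lia.
    by rewrite !pos !absz_nat eqxx.
  have -> : j = - `|j|%N%:Z by lia.
  by rewrite pos neg abszN !absz_nat eqxx !orbT.
have -> : i = - `|i|%N%:Z by lia.
have -> : j = `|j|%N by move: ij0; rewrite (negPf i0) /=; lia.
by rewrite pos neg abszN !absz_nat eqxx !orbT.
Qed.

Lemma tq_dist_le (G : tq_digraph) (x y : tq_vertex G) (i j : int) :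
  (0 <= i) || (0 <= j) ->
  y - x = (i * (tq_a G)%:Z + j * (tq_b G)%:Z)%:~R ->
  (tq_dist x y <= `|i| + `|j|)%N.
Proof.
move=> ij0 yx; rewrite /tq_dist; case: ex_minnP => l _; apply.
by apply/tq_reachP; exists i, j.
Qed.

Lemma tq_dist_attained (G : tq_digraph) (x y : tq_vertex G) :
  exists i j : int,
    [/\ (`|i| + `|j|)%N = tq_dist x y, (0 <= i) || (0 <= j)
      & y - x = (i * (tq_a G)%:Z + j * (tq_b G)%:Z)%:~R].
Proof. by rewrite /tq_dist; case: ex_minnP => l /tq_reachP. Qed.

Lemma lattice_cover (n : nat) (z : int) :
  let a := (n + 1)%N%:Z in let b := (3 * n + 2)%N%:Z in
  let N := (4 * n ^ 2 + 7 * n + 3)%N%:Z in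
  exists i j c : int,
    [/\ (`|i| + `|j| <= 2 * n + 1)%N, (0 <= i) || (0 <= j)
      & i * a + j * b = z + c * N].
Proof.
move=> a b N.
have aE : a = n%:Z + 1 by rewrite /a; lia.
have bE : b = 3 * n%:Z + 2 by rewrite /b; lia.
have NE : N = (4 * n%:Z + 3) * (n%:Z + 1) by rewrite /N; lia.
set M := 4 * n%:Z + 3.
have a0 : a != 0 by rewrite aE; lia.
have M0 : M != 0 by rewrite /M; lia.
(* As [b = 3a - 1], [i a + j b = (i + 3j) a - j]; since [a] divides [N], this forces [j] to be [- z]
   modulo [a]. *)
have zE := divz_eq (- z) a.
have j0 := modz_ge0 (- z) a0.
have ja := ltz_pmod (- z) (_ : 0 < a).
move: zE j0 (ja ltac:(rewrite aE; lia)) => {ja}.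
set q := (- z %/ a)%Z; set j := (- z %% a)%Z => zE j0 ja.
set s := 2 * n%:Z + 1 - j.
(* The first coordinate is now fixed modulo [M]; adding [s] before reducing puts [r - s] in the
   window of length [M] that starts at the left end [- s] of row [j]. *)
have tE := divz_eq (- q - 3 * j + s) M.
have i0 := modz_ge0 (- q - 3 * j + s) M0.
have iM := ltz_pmod (- q - 3 * j + s) (_ : 0 < M).
move: tE i0 (iM ltac:(rewrite /M; lia)) => {iM}.
set c := (_ %/ M)%Z; set r := (_ %% M)%Z => tE r0 rM.
have zE' : (r - s) * a + j * b = z + (- c) * N.
  have -> : z = - (q * a + j) by rewrite -zE opprK.
  have -> : r = - q - 3 * j + s - c * M by rewrite tE; ring.
  by rewrite NE aE bE /M; ring.
have [small|large] := boolP (r <= 2 * s).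
  exists (r - s), j, (- c); split=> //; last by lia.
  by move: small r0 ja; rewrite /s aE; lia.
(* [a + b = M] gives [a a + a b = N], so subtracting [(a, a)] keeps the class. The new coordinates
   are positive and negative, with norm [r - (2n + 1)], and [r <= 4n + 2]. *)
exists (r - s - a), (j - a), (- c - 1); split.
- by move: large r0 rM ja; rewrite /s /M aE; lia.
- by move: large r0 rM ja; rewrite /s /M aE; lia.
- have -> : z + (- c - 1) * N = (z + (- c) * N) - N by ring.
  by rewrite -zE' NE aE bE; ring.
Qed.

Lemma lattice_far (n : nat) (i j c : int) :
  let a := (n + 1)%N%:Z in let b := (3 * n + 2)%N%:Z in
  let N := (4 * n ^ 2 + 7 * n + 3)%N%:Z in
  (0 <= i) || (0 <= j) ->
  (2 * n + 1)%N%:Z * a - (i * a + j * b) = c * N ->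
  (2 * n + 1 <= `|i| + `|j|)%N.
Proof.
move=> a b N ij0 E; rewrite leqNgt; apply/negP => lt_ij.
set M := 4 * n%:Z + 3.
(* [t] is the quotient of [j] by [a], read off from [E] using [b = 3a - 1] and [N = M a]. *)
pose t := c * M + i + 3 * j - 2 * n%:Z - 1.
have jE : j = t * (n%:Z + 1).
  have E' : (2 * n%:Z + 1) * (n%:Z + 1)
            - (i * (n%:Z + 1) + j * (3 * n%:Z + 2))
            = c * ((4 * n%:Z + 3) * (n%:Z + 1)).
    by move: E; rewrite /a /b /N; lia.
  by rewrite /t /M; lia.
have ME : c * M = t - i - 3 * j + 2 * n%:Z + 1 by rewrite /t; ring.
have mono (u p q : int) : 0 <= u -> p <= q -> p * u <= q * u.
  by move=> u0 pq; apply: ler_wpM2r.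
(* Otherwise [|j| >= 2n + 2], against [lt_ij]. *)
have t1 : t = -1 \/ t = 0 \/ t = 1.
  have [t2|[//|t2]] : t <= -2 \/ (t = -1 \/ t = 0 \/ t = 1) \/ 2 <= t by lia.
    by have := mono (n%:Z + 1) _ _ isT t2; rewrite -jE; lia.
  by have := mono (n%:Z + 1) _ _ isT t2; rewrite -jE; lia.
(* For [t = 0, 1, -1] in turn, [c M] is [2n + 1 - i], [- n - 1 - i], [5n + 3 - i]; each lies
   strictly between consecutive multiples of [M]. *)
have c_range : 0 < c * M < M \/ - M < c * M < 0 \/ M < c * M < 2 * M.
  by case: t1 => [|[|]] tE; rewrite ME /M; move: jE; rewrite tE; lia.
have [c1|[c0|[c1|c2]]] : c <= -1 \/ c = 0 \/ c = 1 \/ 2 <= c by lia.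
- by have := mono M _ _ isT c1; lia.
- by move: c_range; rewrite c0; lia.
- by move: c_range; rewrite c1; lia.
- by have := mono M _ _ isT c2; lia.
Qed.

Lemma tq_valid_family (n : nat) : (1 <= n)%N ->
  tq_valid (4 * n ^ 2 + 7 * n + 3) (n + 1) (3 * n + 2).
Proof.
move=> n1; apply/and4P; split; try nia.
(* The gcd reduces to that of the consecutive integers [n + 1] and [n]. *)
have b_pred : (3 * n + 2 = 2 * (n + 1) + n)%N by lia.
have N_mul : (4 * n ^ 2 + 7 * n + 3 = (4 * n + 3) * (n + 1))%N by nia.
rewrite N_mul [gcdn _ (n + 1)]gcdnC gcdnMl b_pred gcdnMDl addn1.
exact: coprimeSn.
Qed.

Lemma tq_diameter_family (n : nat)
    (H : tq_valid (4 * n ^ 2 + 7 * n + 3) (n + 1) (3 * n + 2)) :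
  tq_diameter (TQ H) = (2 * n + 1)%N.
Proof.
have N1 : (1 < 4 * n ^ 2 + 7 * n + 3)%N by nia.
have cong (u v : int) : (u%:~R : tq_vertex (TQ H)) = v%:~R ->
    exists c, u - v = c * (4 * n ^ 2 + 7 * n + 3)%N%:Z.
  by move=> uv; apply/dvdzP; rewrite -intr_Zp_eq0 // intrB -uv subrr.
have N0 : ((4 * n ^ 2 + 7 * n + 3)%N%:Z%:~R : tq_vertex (TQ H)) = 0.
  by apply/eqP; rewrite intr_Zp_eq0 // dvdzz.
apply/eqP; rewrite eqn_leq; apply/andP; split.
  apply/bigmax_leqP => x _; apply/bigmax_leqP => y _.
  have [i [j [c [ij_le ij0 E]]]] := lattice_cover n (nat_of_ord (y - x))%:Z.
  apply: leq_trans ij_le; apply: tq_dist_le => //=.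
  by rewrite E intrD intrM N0 mulr0 addr0 -pmulrn natr_Zp.
pose y : tq_vertex (TQ H) := ((2 * n + 1)%N%:Z * (n + 1)%N%:Z)%:~R.
apply: leq_trans (leq_bigmax (0 : tq_vertex (TQ H))).
apply: leq_trans (leq_bigmax y).
have [i [j [<- ij0]]] := tq_dist_attained _ 0 y.
rewrite subr0 => /cong [c]; exact: lattice_far.
Qed.

Lemma family_order (n : nat) :
  (4 * n ^ 2 + 7 * n + 3)%N%:R =
  (2 * n + 1)%N%:R ^+ 2 + 3%:R / 2%:R * (2 * n + 1)%N%:R + 1 / 2%:R :> rat.
Proof. by rewrite !natrD !natrM; field. Qed.

Theorem proposition2p2 :
  (forall n k N a b : nat,
      (1 <= n)%N ->
      k = (2 * n + 1)%N ->
      N = (4 * n ^ 2 + 7 * n + 3)%N ->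
      a = (n + 1)%N ->
      b = (3 * n + 2)%N ->
      N%:R = k%:R ^+ 2 + 3%:R / 2%:R * k%:R + 1 / 2%:R :> rat /\
      exists H : tq_valid N a b, tq_diameter (TQ H) = k) /\
  (forall k : nat,
      odd k -> (1 < k)%N ->
      exists G : tq_digraph,
        tq_diameter G = k /\
        #|tq_vertex G|%:R = k%:R ^+ 2 + 3%:R / 2%:R * k%:R + 1 / 2%:R :> rat).
Proof.
split=> [n k N a b n1 -> -> -> ->|k k_odd k1].
  split; first exact: family_order.
  by exists (tq_valid_family n n1); exact: tq_diameter_family.
have kE : k = (2 * k./2 + 1)%N by lia.
have n1 : (1 <= k./2)%N by lia.
exists (TQ (tq_valid_family _ n1)); rewrite tq_diameter_family -kE; split=> //.
by rewrite /tq_vertex /= card_ord Zp_cast ?family_order -?kE //; nia.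
Qed.
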